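(* Let $A$ be either $\mathbb{H}$ or $\mathbb{O}$. Let $\Omega\subset A$ be a symmetric slice domain and $f:\Omega\to A$ a non-zero slice-Nash function. Then the zero set $V(f)=\{x\in\Omega: f(x)=0\}$ is a finite union of isolated zeros and isolated spherical zeros.
   Context: $\mathbb{H}$ denotes the quaternions and $\mathbb{O}$ the octonions; $\mathbb{S}_A=\{I\in A: I^2=-1\}$. Put $u_A=1$ if $A=\mathbb{H}$ and $u_A=3$ if $A=\mathbb{O}$. The complex field is $\mathbb{C}=\{\alpha+\iota\beta\}$ with $\iota\notin\mathbb{S}_A$. For $I\in\mathbb{S}_A$, $\mathbb{C}_I=\mathbb{R}+\mathbb{R}I$. For $D\subset\mathbb{C}$, $\Omega_D=\{\alpha+\beta I:\alpha+\iota\beta\in D,\ I\in\mathbb{S}_A\}$; $\Omega\subset A$ is circular if $\Omega=\Omega_D$ for some $D$, where $D$ is always taken invariant under complex conjugation (then it is determined by $\Omega$). A circular domain is an open connected circular set; it is a symmetric slice domain if $\Omega\cap\mathbb{C}_I$ is connected for every $I\in\mathbb{S}_A$ (equivalently $\Omega\cap\mathbb{R}\neq\varnothing$). Elements of $A\otimes_{\mathbb{R}}\mathbb{C}$ are $x+\iota y$ ($x,y\in A$), with $\overline{x+\iota y}=x-\iota y$. A stem function on an open conjugation-invariant $D\subset\mathbb{C}$ is $F=F_1+\iota F_2:D\to A\otimes_{\mathbb{R}}\mathbb{C}$ with $F(\overline z)=\overline{F(z)}$. It induces the slice function $f=\mathcal{I}(F):\Omega_D\to A$, $f(\alpha+\beta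 I)=F_1(\alpha+\iota\beta)+I\,F_2(\alpha+\iota\beta)$; every slice function comes from a unique stem function. $f$ is slice regular if $F$ is holomorphic, i.e. $C^1$ with $\frac{\partial F}{\partial\alpha}+\iota\frac{\partial F}{\partial\beta}=0$. A function $g:D\to\mathbb{C}$ on an open $D\subset\mathbb{C}$ is complex Nash if every point of $D$ has an open neighbourhood $U\subset D$ on which $g$ is holomorphic and satisfies $P(z,g(z))=0$ for some non-zero $P\in\mathbb{C}[z,t]$. For $I\in\mathbb{S}_A$, $A$ is a $\mathbb{C}_I$-vector space by left multiplication; if $\{1,I_1,\ldots,I_{u_A}\}$ is a base over $\mathbb{C}_I$, then $\{I_0:=1,I,I_1,II_1,\ldots,I_{u_A},II_{u_A}\}$ is called a splitting base of $A$ associated to $I$. Write uniquely $F_s=\sum_{k=0}^{u_A}(F_{s,1}^{I,I_k}+F_{s,2}^{I,I_k}I)I_k$ ($s=1,2$) with real-valued coefficients, and $F^{\ell}_{I,I_k}=F_{1,\ell}^{I,I_k}+\iota F_{2,\ell}^{I,I_k}:D\to\mathbb{C}$ ($\ell=1,2$). $F$ is stem-Nash on $D$ if for some $I$ and some splitting base associated to $I$ all $F^{\ell}_{I,I_k}$ are complex Nash on $D$. $f=\mathcal{I}(F)$ is slice-Nash on $\Omega_D$ if it is slice regular and $F$ is stem-Nash on $D$. For $x=\alpha+\beta I\in A$ let $\mathbb{S}_x=\{\alpha+\beta J:J\in\mathbb{S}_A\}$. An isolated zero of $f$ is an isolated point of $V(f)$. An isolated spherical zero of $f$ is a sphere $\mathbb{S}_x\subset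 V(f)$ with $x\in A\setminus\mathbb{R}$ which is isolated in $V(f)$ (it has a neighbourhood $U$ with $U\cap V(f)=\mathbb{S}_x$). *)

(* Defs.v *)
(* Libraries: Mathematical Components, MathComp-Analysis, real-closed (complex). *)
From HB Require Import structures.
From mathcomp Require Import all_boot all_order all_algebra.
From mathcomp Require Import complex.
From mathcomp Require Import all_classical all_reals all_analysis.

Set Implicit Arguments.
Unset Strict Implicit.
Unset Printing Implicit Defensive.

Import Order.TTheory GRing.Theory Num.Theory.
Import numFieldNormedType.Exports.

Local Open Scope classical_set_scope.
Local Open Scope ring_scope.
Local Open Scope complex_scope.

(* The real-valued projections, not those of [numClosedFieldType]. *)
Local Notation Re := complex.Re.
Local Notation Im := complex.Im.

(* The complex field, as a normed module over itself: [open], [continuous] and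
   [derivable] on [Cx R] are the usual complex topological notions. *)
Notation Cx R := (R[i])^o.

Section Algebras.
Variable R : realType.

(* Cayley-Dickson doubling; the levels 0, 1, 2, 3 are the reals, the complex
   numbers, the quaternions and the octonions. The library norm on a product is
   the maximum norm; only the topology, the Euclidean one, is used below. *)
Fixpoint cd (k : nat) : normedModType R :=
  match k with
  | 0 => R^o
  | k'.+1 => (cd k' * cd k')%type
  end.

Fixpoint cd_conj (k : nat) : cd k -> cd k :=
  match k with
  | 0 => fun x => x
  | k'.+1 => fun x => (cd_conj x.1, - x.2)
  end.

Fixpoint cd_one (k : nat) : cd k :=
  match k with
  | 0 => (1 : R)
  | k'.+1 => (cd_one k', 0)
  end.

(* (a, b) (c, d) = (a c - d^* b, d a + b c^* ) *)
Fixpoint cd_mul (k : nat) : cd k -> cd k -> cd k :=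
  match k with
  | 0 => fun x y => (x : R) * (y : R)
  | k'.+1 => fun x y =>
      (cd_mul x.1 y.1 - cd_mul (cd_conj y.2) x.2,
       cd_mul y.2 x.1 + cd_mul x.2 (cd_conj y.1))
  end.

End Algebras.

Inductive alg_name := Quaternions | Octonions.

Definition alg_level (A : alg_name) : nat :=
  match A with Quaternions => 2 | Octonions => 3 end.

Definition alg_u (A : alg_name) : nat :=
  match A with Quaternions => 1 | Octonions => 3 end.

Definition alg (R : realType) (A : alg_name) : normedModType R :=
  cd R (alg_level A).

Section SliceFunctions.
Variables (R : realType) (A : alg_name).
Local Notation alg := (alg R A).

Definition amul (x y : alg) : alg := cd_mul x y.
Definition aone : alg := cd_one R (alg_level A).

Definition imag_units : set alg := [set I | amul I I = - aone].

(* For z = alpha + iota beta, the element alpha + beta I. *)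
Definition slice_pt (z : Cx R) (I : alg) : alg := Re z *: aone + Im z *: I.

Definition slice_plane (I : alg) : set alg := [set slice_pt z I | z in setT].

Definition real_axis : set alg := [set r *: aone | r in setT].

Definition sphere_of (x : alg) : set alg :=
  [set y | exists z I J,
    [/\ imag_units I, imag_units J, x = slice_pt z I & y = slice_pt z J]].

Definition conj_invariant (D : set (Cx R)) := forall z, D z -> D (conjc z).

Definition circularization (D : set (Cx R)) : set alg :=
  [set x | exists z I, [/\ D z, imag_units I & x = slice_pt z I]].

Definition circular (Omega : set alg) :=
  exists2 D, conj_invariant D & Omega = circularization D.

Definition circular_domain (Omega : set alg) :=
  [/\ circular Omega, open Omega & connected Omega].

Definition symmetric_slice_domain (Omega : set alg) :=
  circular_domain Omega /\
  forall I, imag_units I -> connected (Omega `&` slice_plane I).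

(* A (x)_R C, where the pair (x, y) stands for x + iota y. *)
Definition algCx : normedModType R := (alg * alg)%type.

Definition algCx_conj (w : algCx) : algCx := (w.1, - w.2).
Definition algCx_iota (w : algCx) : algCx := (- w.2, w.1).

(* Functions are total; their values off the stated domain are irrelevant. *)
Definition stem_function (D : set (Cx R)) (F : Cx R -> algCx) :=
  [/\ open D, conj_invariant D
    & forall z, D z -> F (conjc z) = algCx_conj (F z)].

Definition induces (D : set (Cx R)) (F : Cx R -> algCx) (f : alg -> alg) :=
  forall z I, D z -> imag_units I ->
    f (slice_pt z I) = (F z).1 + amul I (F z).2.

Definition along_re (F : Cx R -> algCx) (z : Cx R) : R -> algCx :=
  fun a => F (a +i* Im z).
Definition along_im (F : Cx R -> algCx) (z : Cx R) : R -> algCx :=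
  fun b => F (Re z +i* b).

Definition d_re (F : Cx R -> algCx) (z : Cx R) : algCx :=
  derive1 (along_re F z) (Re z).
Definition d_im (F : Cx R -> algCx) (z : Cx R) : algCx :=
  derive1 (along_im F z) (Im z).

Definition C1_on (D : set (Cx R)) (F : Cx R -> algCx) :=
  forall z, D z ->
    [/\ derivable (along_re F z : R^o -> algCx) (Re z) 1,
        derivable (along_im F z : R^o -> algCx) (Im z) 1,
        {for z, continuous (d_re F)}
      & {for z, continuous (d_im F)}].

Definition holomorphic_stem (D : set (Cx R)) (F : Cx R -> algCx) :=
  C1_on D F /\ forall z, D z -> d_re F z + algCx_iota (d_im F z) = 0.

(* P is a polynomial in t whose coefficients are polynomials in z. *)
Definition complex_nash (D : set (Cx R)) (g : Cx R -> Cx R) :=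
  forall z, D z -> exists U : set (Cx R),
    [/\ open U, U z, U `<=` D,
        forall w, U w -> derivable g w 1
      & exists2 P : {poly {poly R[i]}}, P != 0 &
          forall w, U w -> P.[(g w)%:P].[w] = 0].

(* e = (1, I_1, ..., I_u) is a base of A over C_I acting by left
   multiplication; [slice_pt c I] is the scalar of C_I with coordinates c. *)
Definition splitting_base (I : alg) (e : 'I_(alg_u A).+1 -> alg) :=
  [/\ e ord0 = aone,
      forall c : 'I_(alg_u A).+1 -> Cx R,
        \sum_k amul (slice_pt (c k) I) (e k) = 0 -> forall k, c k = 0
    & forall x, exists c : 'I_(alg_u A).+1 -> Cx R,
        x = \sum_k amul (slice_pt (c k) I) (e k)].

(* [G1 k] and [G2 k] are F^1_(I,I_k) and F^2_(I,I_k) on D, where they are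
   uniquely determined: their real parts are the coordinates of F_1 and their
   imaginary parts those of F_2. *)
Definition splitting_components (D : set (Cx R)) (F : Cx R -> algCx)
    (I : alg) (e : 'I_(alg_u A).+1 -> alg)
    (G1 G2 : 'I_(alg_u A).+1 -> Cx R -> Cx R) :=
  forall z, D z ->
    (F z).1 =
      \sum_k amul (slice_pt (Re (G1 k z) +i* Re (G2 k z)) I) (e k) /\
    (F z).2 =
      \sum_k amul (slice_pt (Im (G1 k z) +i* Im (G2 k z)) I) (e k).

Definition stem_nash (D : set (Cx R)) (F : Cx R -> algCx) :=
  exists I e G1 G2,
    [/\ imag_units I, splitting_base I e,
        splitting_components D F I e G1 G2
      & forall k, complex_nash D (G1 k) /\ complex_nash D (G2 k)].

Definition slice_nash (Omega : set alg) (f : alg -> alg) :=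
  exists D F,
    [/\ Omega = circularization D, stem_function D F, induces D F f,
        holomorphic_stem D F & stem_nash D F].

Definition zero_set (Omega : set alg) (f : alg -> alg) : set alg :=
  [set x | Omega x /\ f x = 0].

(* The isolated zeros are the elements of [isolated (zero_set Omega f)]. *)
Definition isolated_spherical_zero (Omega : set alg) (f : alg -> alg)
    (S : set alg) :=
  exists x,
    [/\ ~ real_axis x, S = sphere_of x, S `<=` zero_set Omega f
      & exists2 U, open U & U `&` zero_set Omega f = S].

End SliceFunctions.

(* Main.v *)
Require Import Defs.
From HB Require Import structures.
From mathcomp Require Import all_boot all_order all_algebra.
From mathcomp Require Import complex.
From mathcomp Require Import all_classical all_reals all_analysis.
From mathcomp Require Import ring lra.
Import Order.TTheory GRing.Theory Num.Theory.
Import numFieldNormedType.Exports.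
Local Open Scope classical_set_scope.
Local Open Scope ring_scope.

(* The stem function F has real values on the real points of D, and its normal
   function N = |F_1|^2 - |F_2|^2 + 2 iota <F_1, F_2> is a quadratic form in the
   Nash components of F, hence continuous and locally algebraic over C[z]. No
   complex analysis is needed beyond this: if P(z, g) = 0 with P = t^m Q and
   b(z) = Q(z, 0) <> 0, then away from the roots of b the zero set of a
   continuous g is open and closed. Since a punctured disc is connected, such
   functions obey the identity principle, so a single P works on the whole of
   the connected set D, and g is either zero or has finitely many zeros. If N
   were zero, F would vanish on the real points of D, hence everywhere; so N has
   finitely many zeros. By multiplicativity of the norm each zero of f lies on a
   sphere over a zero of N, and f vanishes either on the whole of that sphere or
   at a single point of it. *)

Set Implicit Arguments.
Unset Strict Implicit.
Unset Printing Implicit Defensive.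

(** * Cayley-Dickson algebras: product, unit and inner product *)

Section CayleyDickson.
Variable R : realType.
Implicit Types (k : nat) (a : R).

Fixpoint cd_re k : cd R k -> R :=
  match k with 0 => fun x => x | k'.+1 => fun x => cd_re x.1 end.

Fixpoint cd_dot k : cd R k -> cd R k -> R :=
  match k with
  | 0 => fun x y => (x : R) * (y : R)
  | k'.+1 => fun x y => cd_dot x.1 y.1 + cd_dot x.2 y.2
  end.

Lemma cd_dotC k (x y : cd R k) : cd_dot x y = cd_dot y x.
Proof. by elim: k x y => [|k IH] x y /=;
  [rewrite mulrC|rewrite (IH x.1) (IH x.2)]. Qed.

Lemma cd_dot_is_linear k a (x y z : cd R k) :
  cd_dot x (a *: y + z) = a * cd_dot x y + cd_dot x z.
Proof.
elim: k x y z => [|k IH] x y z /=; last by rewrite !IH; ring.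
by rewrite /GRing.scale/=; ring.
Qed.

Lemma cd_dotxx_ge0 k (x : cd R k) : 0 <= cd_dot x x.
Proof.
by elim: k x => [|k IH] x /=; [rewrite -expr2 sqr_ge0|rewrite addr_ge0].
Qed.

Lemma cd_dotxx_eq0 k (x : cd R k) : cd_dot x x = 0 -> x = 0.
Proof.
elim: k x => [|k IH] x /=; first by move/eqP; rewrite -expr2 sqrf_eq0 => /eqP.
case: x => x y /= /eqP; rewrite paddr_eq0 ?cd_dotxx_ge0// =>
  /andP[/eqP/IH -> /eqP/IH ->].
by [].
Qed.

Lemma cd_conj_is_linear k a (x y : cd R k) :
  cd_conj (a *: x + y) = a *: cd_conj x + cd_conj y.
Proof.
elim: k x y => [//|k IH] x y /=; rewrite IH.
by congr pair; rewrite /= opprD scalerN.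
Qed.

(** Left and right linearity share one induction: the doubling formula places each factor on the
    left of some products and on the right of others. *)
Lemma cd_mul_is_linear k :
  (forall a (x y z : cd R k),
    cd_mul (a *: x + y) z = a *: cd_mul x z + cd_mul y z) /\
  (forall a (x y z : cd R k),
    cd_mul z (a *: x + y) = a *: cd_mul z x + cd_mul z y).
Proof.
elim: k => [|k [IHl IHr]] /=.
  by split=> a x y z; rewrite /GRing.scale/=; ring.
split=> a x y z.
  by rewrite !IHl !IHr; congr pair; rewrite /= ?scalerDr ?scalerN ?opprD;
    rewrite !addrA; congr (_ + _); rewrite -!addrA; congr (_ + _);
    rewrite addrC.
rewrite !cd_conj_is_linear !IHl !IHr.
by congr pair; rewrite /= ?scalerDr ?scalerN ?opprD; rewrite !addrA;
  congr (_ + _); rewrite -!addrA; congr (_ + _); rewrite addrC.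
Qed.

Lemma cd_mulDl k (x y z : cd R k) : cd_mul (x + y) z = cd_mul x z + cd_mul y z.
Proof. by have := (cd_mul_is_linear k).1 1 x y z; rewrite !scale1r. Qed.

Lemma cd_mulDr k (x y z : cd R k) : cd_mul z (x + y) = cd_mul z x + cd_mul z y.
Proof. by have := (cd_mul_is_linear k).2 1 x y z; rewrite !scale1r. Qed.

Lemma cd_mul0l k (x : cd R k) : cd_mul 0 x = 0.
Proof. by apply: (addIr (cd_mul 0 x)); rewrite -cd_mulDl !add0r. Qed.

Lemma cd_mul0r k (x : cd R k) : cd_mul x 0 = 0.
Proof. by apply: (addIr (cd_mul x 0)); rewrite -cd_mulDr !add0r. Qed.

Lemma cd_mulZl k a (x z : cd R k) : cd_mul (a *: x) z = a *: cd_mul x z.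
Proof. by have := (cd_mul_is_linear k).1 a x 0 z; rewrite cd_mul0l !addr0. Qed.

Lemma cd_mulZr k a (x z : cd R k) : cd_mul z (a *: x) = a *: cd_mul z x.
Proof. by have := (cd_mul_is_linear k).2 a x 0 z; rewrite cd_mul0r !addr0. Qed.

Lemma cd_conj1 k : cd_conj (cd_one R k) = cd_one R k.
Proof. by elim: k => [//|k IH] /=; rewrite IH oppr0. Qed.

Lemma cd_conj0 k : cd_conj (0 : cd R k) = 0.
Proof. by elim: k => [//|k IH] /=; rewrite IH oppr0. Qed.

Lemma cd_mul1 k :
  (forall x : cd R k, cd_mul (cd_one R k) x = x) /\
  (forall x : cd R k, cd_mul x (cd_one R k) = x).
Proof.
elim: k => [|k [IHl IHr]] /=; first by split=> x; rewrite (mul1r,mulr1).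
split=> -[x y] /=.
  by rewrite IHl IHr cd_mul0r cd_mul0l subr0 addr0.
by rewrite cd_conj0 cd_conj1 !IHr !cd_mul0l subr0 add0r.
Qed.

Lemma cd_dot0r k (x : cd R k) : cd_dot x 0 = 0.
Proof. by have := cd_dot_is_linear (-1) x 0 0;
  rewrite scaleN1r addNr mulN1r addNr. Qed.

Lemma cd_dotZr k a (x y : cd R k) : cd_dot x (a *: y) = a * cd_dot x y.
Proof. by have := cd_dot_is_linear a x y 0; rewrite !addr0 cd_dot0r addr0. Qed.

Lemma cd_dotDr k (x y z : cd R k) : cd_dot x (y + z) = cd_dot x y + cd_dot x z.
Proof. by have := cd_dot_is_linear 1 x y z; rewrite scale1r mul1r. Qed.

Lemma cd_dotx1 k (x : cd R k) : cd_dot x (cd_one R k) = cd_re x.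
Proof. by elim: k x => [|k IH] x /=; rewrite ?mulr1// IH cd_dot0r addr0. Qed.

Lemma cd_re1 k : cd_re (cd_one R k) = 1.
Proof. by elim: k. Qed.

End CayleyDickson.

(** * Norm identities in the quaternions and octonions *)

Section Alg.
Variables (R : realType) (A : alg_name).
Implicit Types x y : alg R A.

(** Euler's four-square and Degen's eight-square identities, polynomial identities in the
    coordinates; further doublings lose them, hence the case split on the two algebras. *)
Lemma amul_dot x y : cd_dot (amul x y) (amul x y) = cd_dot x x * cd_dot y y.
Proof.
case: A x y => /=.
  by move=> [[x1 x2] [x3 x4]] [[y1 y2] [y3 y4]]; rewrite /amul /=; ring.
move=> [[[x1 x2] [x3 x4]] [[x5 x6] [x7 x8]]].
by move=> [[[y1 y2] [y3 y4]] [[y5 y6] [y7 y8]]]; rewrite /amul /=; ring.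
Qed.

(** Polarised multiplicativity, <x y, 1 y> = <x, 1> <y, y>; for an imaginary unit x it makes x y
    orthogonal to y. *)
Lemma amul_dotr x y : cd_dot (amul x y) y = cd_re x * cd_dot y y.
Proof.
case: A x y => /=.
  by move=> [[x1 x2] [x3 x4]] [[y1 y2] [y3 y4]]; rewrite /amul /=; ring.
move=> [[[x1 x2] [x3 x4]] [[x5 x6] [x7 x8]]].
by move=> [[[y1 y2] [y3 y4]] [[y5 y6] [y7 y8]]]; rewrite /amul /=; ring.
Qed.

(** The real part of the quadratic equation x^2 = 2 Re(x) x - |x|^2. *)
Lemma re_sqr x : cd_re (amul x x) = 2 * cd_re x ^+ 2 - cd_dot x x.
Proof.
case: A x => /=.
  by move=> [[x1 x2] [x3 x4]]; rewrite /amul /=; ring.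
by move=> [[[x1 x2] [x3 x4]] [[x5 x6] [x7 x8]]]; rewrite /amul /=; ring.
Qed.

End Alg.

(** * Functions algebraic over C[z] and their ring operations *)

Section Algebraic.
Variable R : realType.
Local Notation C := R[i].
Implicit Types (g h : Cx R -> C) (z w : Cx R).
Implicit Types (a b p : {poly C}) (P Q : {poly {poly C}}).

(** As a ring morphism into all functions, it makes integrality over C[z] available there. *)
Definition polyfun p : Cx R -> C := fun w => p.[w].

Lemma polyfun_is_zmod_morphism : zmod_morphism polyfun.
Proof. by move=> p q; apply/funext => w; rewrite /polyfun hornerD hornerN. Qed.

Lemma polyfun_is_monoid_morphism : monoid_morphism polyfun.
Proof.
split; first by apply/funext => w; rewrite /polyfun hornerC.
by move=> p q; apply/funext => w; rewrite /polyfun hornerM.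
Qed.

HB.instance Definition _ := GRing.isZmodMorphism.Build _ _ polyfun
  polyfun_is_zmod_morphism.
HB.instance Definition _ := GRing.isMonoidMorphism.Build _ _ polyfun
  polyfun_is_monoid_morphism.

Lemma horner2_evalr P p w : P.[p].[w] = P.[p.[w]%:P].[w].
Proof.
elim/poly_ind: P => [|P c IH]; first by rewrite !horner0.
by rewrite !hornerE IH.
Qed.

Lemma horner_polyfun P g w : (map_poly polyfun P).[g] w = P.[(g w)%:P].[w].
Proof.
elim/poly_ind: P => [|P c IH]; first by rewrite rmorph0 !horner0.
by rewrite rmorphD rmorphM /= map_polyX map_polyC /= !hornerE /= -IH.
Qed.

Definition algebraic_fun g :=
  exists2 P, P != 0 & forall w, P.[(g w)%:P].[w] = 0.

(* If a is the leading coefficient of P then a g is integral over C[z]. *)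
Lemma algebraic_integral g :
  algebraic_fun g <-> exists2 a, a != 0 & integralOver polyfun (polyfun a * g).
Proof.
split=> [[P0 P0_neq0 P0g]|[a a0 [Q Qm /rootP Qg]]]; last first.
  (* Substituting a t for t turns a monic relation for a g into a nonzero relation for g. *)
  exists (Q \Po (a *: 'X)); first by rewrite comp_poly_eq0 ?monic_neq0//
    size_scale// size_polyX.
  move=> w; rewrite horner_comp hornerZ hornerX horner2_evalr hornerM hornerC.
  by move/(congr1 (@^~ w)): Qg; rewrite horner_polyfun.
(* The factor t makes the degree of P positive, so that it can be written n + 1. *)
pose P := P0 * 'X.
have Pg w : P.[(g w)%:P].[w] = 0 by rewrite /P hornerM hornerM P0g mul0r.
have P_neq0 : P != 0 by rewrite mulf_neq0 ?polyX_eq0.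
have [n sP] : exists n, size P = n.+2.
  by rewrite /P size_mulX//; move: P0_neq0; rewrite -size_poly_gt0;
    case: size => // n _; exists n.
pose a := lead_coef P; have a0 : a != 0 by rewrite lead_coef_eq0.
exists a => //.
(* This is a^n P(t / a), with n + 1 the degree of P; its leading coefficient a^n a / a^(n+1) is
   1. *)
pose Q := \poly_(i < n.+2) (if i == n.+1 then 1 else P`_i * a ^+ (n - i)).
exists Q.
  by apply/monicP; rewrite lead_coef_poly// eqxx// oner_eq0.
apply/rootP/funext => w; rewrite horner_polyfun.
suff -> : Q.[((polyfun a * g) w)%:P].[w] = a.[w] ^+ n * P.[(g w)%:P].[w].
  by rewrite Pg mulr0.
rewrite (@horner_coef_wide _ n.+2 Q) ?size_poly// (@horner_coef_wide _ n.+2 P)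
  ?sP//.
rewrite !horner_sum mulr_sumr; apply: eq_bigr => i _.
rewrite coef_poly ltn_ord !hornerM !horner_exp !hornerC /= exprMn.
case: eqVneq => [->|ni]; rewrite ?hornerC.
  by rewrite mul1r exprS /a /lead_coef sP /= /polyfun /=; ring.
have le_in : (i <= n)%N by have := ltn_ord i;
  rewrite ltnS leq_eqVlt (negbTE ni).
rewrite hornerM horner_exp /polyfun /= mulrA -(mulrA _ (_ ^+ _)) -exprD subnK//.
by rewrite mulrCA mulrA.
Qed.

(** Integral elements form a ring, and a b is a common denominator of g and h. *)
Lemma algebraic_funD g h :
  algebraic_fun g -> algebraic_fun h -> algebraic_fun (g + h).
Proof.
move=> /algebraic_integral[a a0 ag] /algebraic_integral[b b0 bh].
apply/algebraic_integral; exists (a * b); first by rewrite mulf_neq0.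
rewrite rmorphM/= mulrDr {1}(mulrC (polyfun a)) -!mulrA.
by apply: integral_add; apply: integral_mul => //; exact: integral_id.
Qed.

Lemma algebraic_funM g h :
  algebraic_fun g -> algebraic_fun h -> algebraic_fun (g * h).
Proof.
move=> /algebraic_integral[a a0 ag] /algebraic_integral[b b0 bh].
apply/algebraic_integral; exists (a * b); first by rewrite mulf_neq0.
by rewrite rmorphM/= mulrACA; apply: integral_mul.
Qed.

Lemma algebraic_polyfun p : algebraic_fun (polyfun p).
Proof.
exists ('X - p%:P); first by rewrite polyXsubC_eq0.
by move=> w; rewrite !hornerE subrr.
Qed.

Definition algebraic_near z g := exists2 P, P != 0 &
  \forall w \near z, P.[(g w)%:P].[w] = 0.

(** A local relation becomes global by setting the function to 0 where P fails to annihilate it and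
    multiplying P by t. Local sums and products thus reduce to global ones. *)
Lemma algebraic_nearP z g : algebraic_near z g <->
  exists2 h, algebraic_fun h & \forall w \near z, g w = h w.
Proof.
split=> [[P P0 Pg]|[h [P P0 Ph] gh]]; last first.
  by exists P => //; apply: filterS gh => w ->.
exists (fun w => if `[<P.[(g w)%:P].[w] = 0>] then g w else 0).
  exists (P * 'X); first by rewrite mulf_neq0 ?polyX_eq0.
  move=> w; rewrite !hornerM hornerX hornerC.
  by case: asboolP => [->|]; rewrite ?mul0r ?mulr0.
by apply: filterS Pg => w; case: asboolP.
Qed.

Lemma algebraic_nearD z g h : algebraic_near z g -> algebraic_near z h ->
  algebraic_near z (g + h).
Proof.
move=> /algebraic_nearP[g' ag gg'] /algebraic_nearP[h' ah hh'].
apply/algebraic_nearP; exists (g' + h'); first exact: algebraic_funD.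
by apply: filterS2 gg' hh' => w ??; congr (_ + _).
Qed.

Lemma algebraic_nearM z g h : algebraic_near z g -> algebraic_near z h ->
  algebraic_near z (g * h).
Proof.
move=> /algebraic_nearP[g' ag gg'] /algebraic_nearP[h' ah hh'].
apply/algebraic_nearP; exists (g' * h'); first exact: algebraic_funM.
by apply: filterS2 gg' hh' => w ??; congr (_ * _).
Qed.

Lemma algebraic_near_polyfun z p : algebraic_near z (polyfun p).
Proof. by apply/algebraic_nearP; exists (polyfun p);
  [exact: algebraic_polyfun|near=> w].
Unshelve. all: by end_near. Qed.

End Algebraic.

(** * Continuity and zeros of algebraic functions *)

Section AlgebraicContinuous.
Variable R : realType.
Local Notation C := R[i].
Implicit Types (g : Cx R -> Cx R) (z w : Cx R).
Implicit Types (b p : {poly C}) (P Q : {poly {poly C}}).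

Lemma continuous_horner p : continuous (polyfun p : Cx R -> Cx R).
Proof.
elim/poly_ind: p => [|p c IH] z.
  have -> : polyfun (0 : {poly C}) = cst 0 by apply/funext => w;
    rewrite /polyfun horner0.
  exact: cst_continuous.
have -> : polyfun (p * 'X + c%:P) =
    (fun w : Cx R => (polyfun p w : Cx R) * w + c).
  by apply/funext => w; rewrite /polyfun !hornerE.
apply: (@continuousD _ _ _ (fun w => polyfun p w * w : Cx R) (cst (c : Cx R))).
  by apply: (@continuousM _ _ (polyfun p : Cx R -> Cx R) (fun w : Cx R => w));
    [exact: IH|exact: cvg_id].
exact: cst_continuous.
Qed.

Lemma continuous_horner2 P g z : {for z, continuous g} ->
  {for z, continuous (fun w => P.[(g w)%:P].[w] : Cx R)}.
Proof.
move=> cg; elim/poly_ind: P => [|P c IH].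
  have -> : (fun w => (0 : {poly {poly C}}).[(g w)%:P].[w] : Cx R) = cst 0.
    by apply/funext => w; rewrite !horner0.
  exact: cst_continuous.
have -> : (fun w => (P * 'X + c%:P).[(g w)%:P].[w] : Cx R) =
    (fun w : Cx R => (P.[(g w)%:P].[w] : Cx R) * g w + polyfun c w).
  by apply/funext => w; rewrite /polyfun !hornerE.
apply: (@continuousD _ _ _ (fun w => P.[(g w)%:P].[w] * g w : Cx R)
  (polyfun c : Cx R -> Cx R)).
  by apply: (@continuousM _ _ (fun w => P.[(g w)%:P].[w] : Cx R) g);
    [exact: IH|exact: cg].
exact: continuous_horner.
Qed.

Lemma near_neq0 g z : {for z, continuous g} -> g z != 0 ->
  \forall w \near z, g w != 0.
Proof. by move=> cg gz; exact: (cvgr_neq0 _ cg gz). Qed.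

Lemma horner_neq0_punctured p z : p != 0 ->
  \forall w \near z, w != z -> p.[w] != 0.
Proof.
move=> p0; have [m [q /implyP/(_ p0) qz ->]] := multiplicity_XsubC p z.
have := near_neq0 (@continuous_horner q z) qz; apply: filterS => w qw wz.
by rewrite hornerM mulf_neq0// horner_exp expf_neq0// !hornerE subr_eq0.
Qed.

(* The witness b is Q(z, 0), where P = t^m Q and Q(z, 0) is not zero. *)
Lemma algebraic_zero_near P : P != 0 -> exists2 b, b != 0 &
  forall g w, (\forall v \near w, P.[(g v)%:P].[v] = 0) ->
    {for w, continuous g} -> g w = 0 -> b.[w] != 0 ->
    \forall v \near w, g v = 0.
Proof.
move=> P0; have [m [Q /implyP/(_ P0) Q0 PE]] := multiplicity_XsubC P 0.
exists Q.[0] => // g w Pg cg gw0 bw.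
have Qw : Q.[(g w)%:P].[w] != 0 by rewrite gw0.
have := near_neq0 (continuous_horner2 (P := Q) cg) Qw.
apply: filterS2 Pg => v Pv Qv.
move/eqP: Pv; rewrite PE hornerM hornerM mulf_eq0 (negbTE Qv)/=.
by rewrite horner_exp horner_exp polyC0 subr0 hornerX hornerC expf_eq0 =>
  /andP[_ /eqP].
Qed.

End AlgebraicContinuous.

(** * Topology of the complex plane: coordinates and punctured discs *)

Section ComplexTopology.
Variable R : realType.
Local Notation C := R[i].
Local Notation Re := (@complex.Re R).
Local Notation Im := (@complex.Im R).
Implicit Types (z w : Cx R) (D : set (Cx R)).

Lemma normr_real_complex (x : R) : `|x%:C%C| = `|x|%:C%C.
Proof. by rewrite normc_def /= expr0n addr0 sqrtr_sqr. Qed.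

Lemma continuous_real_complex : continuous (fun x : R => x%:C%C : Cx R).
Proof.
move=> x; apply/cvgrPdist_lt => e; rewrite ltcE => /= /andP[/eqP Ie e0].
have : \forall y \near x, `|x - y| < Re e by exact: near_ball.
apply: filterS => y; rewrite -rmorphB normr_real_complex.
by rewrite ltcE /= Ie eqxx.
Qed.

Lemma continuous_Re : continuous (Re : Cx R -> R).
Proof.
move=> z; apply/(@cvgrPdist_lt _ _ _ (nbhs (z : Cx R)) _) => e e0.
have e0C : 0 < e%:C%C by rewrite ltcR.
have := near_ball z _ e0C; apply: filterS => w; rewrite -ball_normE /=;
  have -> : Re z - Re w = Re (z - w) by case: z => ??; case: w.
by move=> /(le_lt_trans (normc_ge_Re _)); rewrite ltcR.
Qed.

Lemma continuous_Im : continuous (Im : Cx R -> R).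
Proof.
have -> : (Im : Cx R -> R) = (fun z : Cx R => Re (z * (- 'i%C))).
  by apply/funext => -[x y] /=; rewrite mulrN1 opprK oppr0 mulr0 add0r.
move=> z; apply: continuous_comp; last exact: continuous_Re.
apply: (@continuousM _ _ (fun w : Cx R => w) (cst (- 'i%C : Cx R))).
  exact: cvg_id.
exact: cst_continuous.
Qed.

Lemma continuous_complex (T : topologicalType) (u v : T -> R) :
  continuous u -> continuous v -> continuous (fun x => u x +i* v x : Cx R)%C.
Proof.
move=> cu cv x.
have -> : (fun x => u x +i* v x : Cx R)%C =
    (fun x => (u x)%:C%C + (v x)%:C%C * 'i%C).
  apply/funext => t; apply/eqP; rewrite eq_complex /=.
  by rewrite !(mulr0,mul0r,mulr1,addr0,subr0,add0r) !eqxx.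
apply: (@continuousD _ _ _ (fun x => (u x)%:C%C : Cx R)
  (fun x => (v x)%:C%C * 'i%C : Cx R)).
  by apply: (@continuous_comp _ _ _ u (fun r : R => r%:C%C : Cx R));
    [exact: cu|exact: continuous_real_complex].
apply: (@continuousM _ _ (fun x => (v x)%:C%C : Cx R) (cst ('i%C : Cx R)));
  last exact: cst_continuous.
by apply: (@continuous_comp _ _ _ v (fun r : R => r%:C%C : Cx R));
  [exact: cv|exact: continuous_real_complex].
Qed.

(** The set is the union of the segments from a base point. *)
Lemma convex_connected D :
  (forall x y (t : R), D x -> D y -> 0 <= t <= 1 -> D (x + t%:C%C * (y - x))) ->
  connected D.
Proof.
move=> cD; have [->|/set0P[x Dx]] := eqVneq D set0; first exact: connected0.
pose s y (t : R) : Cx R := x + t%:C%C * (y - x).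
have -> : D = \bigcup_(y in D) (s y @` `[0, 1]).
  apply/seteqP; split=> [y Dy|y [v Dv [t + <-]]].
    exists y => //; exists 1; first by rewrite /= in_itv /= ler01 lexx.
    by rewrite /s mul1r addrC subrK.
  by rewrite /= in_itv /= => /cD; exact.
apply: bigcup_connected.
  exists x => y Dy; exists 0; first by rewrite /= in_itv /= lexx ler01.
  by rewrite /s mul0r addr0.
move=> y Dy; apply: connected_continuous_connected;
  first exact: segment_connected.
apply: continuous_subspaceT => t.
apply: (@continuousD _ _ _ (cst x) (fun t : R => t%:C%C * (y - x) : Cx R)).
  exact: cst_continuous.
apply: (@continuousM _ _ (fun t : R => t%:C%C : Cx R) (cst (y - x : Cx R))).
  exact: continuous_real_complex.
exact: cst_continuous.
Qed.

(** An open half disc cut off by a line through z; u fixes its direction. *)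
Let half z (r u : C) : set (Cx R) :=
  ball z r `&` [set w | 0 < Re (u * (w - z))].

Lemma half_ball_connected z (r u : C) : connected (half z r u).
Proof.
apply: convex_connected => x y t [+ xu] [+ yu] /andP[t0 t1].
rewrite -!ball_normE /= => xr yr; split.
  rewrite -ball_normE /=.
  have -> : z - (x + t%:C%C * (y - x)) =
      (1 - t)%:C%C * (z - x) + t%:C%C * (z - y).
    by rewrite rmorphB/=; ring.
  apply: le_lt_trans (ler_normD _ _) _; rewrite !normrM !normr_real_complex.
  have t1' : 0 <= 1 - t by rewrite subr_ge0.
  rewrite (ger0_norm t0) (ger0_norm t1').
  have -> : r = (1 - t)%:C%C * r + t%:C%C * r by rewrite rmorphB/=; ring.
  (* For t = 1 the first weight vanishes, and strictness has to come from y. *)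
  have [->|t_neq1] := eqVneq t 1;
    first by rewrite subrr rmorph0 rmorph1 !mul0r !add0r !mul1r.
  apply: ltr_leD; first by rewrite ltr_pM2l// ltcR subr_gt0 lt_neqAle t_neq1 t1.
  by rewrite ler_wpM2l ?ler0c// ltW.
rewrite /=; have -> : Re (u * (x + t%:C%C * (y - x) - z)) =
    (1 - t) * Re (u * (x - z)) + t * Re (u * (y - z)).
  by case: u x y z xu yu {xr yr} => [u1 u2] [x1 x2] [y1 y2] [z1 z2] _ _ /=;
    ring.
have [->|t_neq1] := eqVneq t 1; first by rewrite subrr mul0r add0r mul1r.
rewrite ltr_wpDr// ?mulr_ge0 ?(ltW yu)//.
by rewrite mulr_gt0// subr_gt0 lt_neqAle t_neq1 t1.
Qed.

(* The punctured disc is a cycle of four half discs, each meeting the next. *)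
Lemma punctured_ball_connected z (r : C) : 0 < r -> connected (ball z r `\ z).
Proof.
move=> r0.
(* A direction c with |c| <= 2 common to two half planes gives the common point z + (r/4) c; the
   diagonal directions serve below. *)
have meet (u v c : C) : `|c| <= 2 -> 0 < Re (u * c) -> 0 < Re (v * c) ->
    half z r u `&` half z r v !=set0.
  have [s rs] : exists s : R, r = s%:C%C.
    by exists (Re r); rewrite RRe_real// gtr0_real.
  have s0 : 0 < s by move: r0; rewrite rs ltcR.
  rewrite rs => c2 uc vc.
  have cM (v' : C) : Re (v' * (z + (s / 4)%:C%C * c - z)) = s / 4 * Re (v' * c).
    by case: v' c z {c2 uc vc} => [v1 v2] [c1 c2] [z1 z2] /=; ring.
  have bc : ball z s%:C%C (z + (s / 4)%:C%C * c).
    rewrite -ball_normE /= opprD addNKr normrN normrM normr_real_complex.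
    have s4 : 0 <= s / 4 by rewrite divr_ge0// ltW.
    have s4C : 0 <= (s / 4)%:C%C by rewrite ler0c.
    rewrite (ger0_norm s4).
    apply: (le_lt_trans (ler_wpM2l s4C c2)).
    have -> : (2 : C) = 2%:C%C by rewrite rmorph_nat.
    by rewrite -rmorphM ltcR; lra.
  by exists (z + (s / 4)%:C%C * c); split; split => //=;
    rewrite cM mulr_gt0// divr_gt0.
have norm2 (c : C) : `|Re c| <= 1 -> `|Im c| <= 1 -> `|c| <= 2.
  move=> cR cI; rewrite (complexE c) (le_trans (ler_normD _ _))//.
  rewrite normrM !normr_real_complex normc_def /= expr0n expr1n add0r sqrtr1
    mul1r.
  have -> : (2 : C) = 2%:C%C by rewrite rmorph_nat.
  by rewrite -rmorphD lecR; lra.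
pose i : C := 'i%C.
have -> : ball z r `\ z = half z r 1 `|` half z r (- i) `|` half z r (- 1) `|`
    half z r i.
  apply/seteqP; split=> [w [zw wz]|w]; last first.
    case=> [[[]|]|] [zw /= H]; split => //; move: H => /[swap] ->;
      by rewrite subrr mulr0 ltxx.
  have : w - z != 0 by rewrite subr_eq0; apply/eqP.
  rewrite /half /i /=; case: (w - z) => x y.
  rewrite eq_complex /= negb_and !neq_lt.
  rewrite !(mul0r,mul1r,mulN1r,oppr0,sub0r,subr0,opprK,oppr_gt0,oppr_lt0).
  by move=> /orP[]/orP[]; tauto.
apply: connectedU; last exact: half_ball_connected; last first.
  apply: connectedU; last exact: half_ball_connected; last first.
    apply: connectedU; last exact: half_ball_connected;
      last exact: half_ball_connected.
    by apply: (meet _ _ (1 +i* 1)%C); rewrite /i ?norm2//= ?normr1//; lra.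
  suff [w [w1 w2]] : half z r (- i) `&` half z r (-1) !=set0 by exists w;
    split => //; right.
  by apply: (meet _ _ ((-1) +i* 1)%C); rewrite /i ?norm2//= ?normrN ?normr1//;
    lra.
suff [w [w1 w2]] : half z r (-1) `&` half z r i !=set0 by exists w;
  split => //; right.
by apply: (meet _ _ ((-1) +i* (-1))%C); rewrite /i ?norm2//= ?normrN ?normr1//;
  lra.
Qed.

End ComplexTopology.

(** * The identity principle for continuous algebraic functions *)

Section AlgebraicIdentity.
Variable R : realType.
Local Notation C := R[i].
Implicit Types (g h : Cx R -> Cx R) (z w : Cx R) (D : set (Cx R)).
Implicit Types (p : {poly C}) (P : {poly {poly C}}).

(** On a punctured disc without roots of b, the zeros of g are open by the algebraic relation and
    closed by continuity, so they fill it or are absent. *)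
Lemma algebraic_dichotomy g z :
  (\forall w \near z, {for w, continuous g}) -> algebraic_near z g ->
  (\forall w \near z, g w = 0) \/ (\forall w \near z, w != z -> g w != 0).
Proof.
move=> cg [P P0 Pg].
have [b b0 zb] := algebraic_zero_near P0.
have bz := horner_neq0_punctured z b0.
have /nbhs_ballP[r /= r0 rz] :
    nbhs z ([set w | P.[(g w)%:P].[w] = 0]° `&`
      ([set w | {for w, continuous g}] `&` [set w | w != z -> b.[w] != 0])).
  by apply: filterI (nbhs_interior Pg) (filterI cg bz).
pose S := ball z r `\ z.
have near_zero w : S w -> g w = 0 -> \forall v \near w, g v = 0.
  move=> [/rz[Pw [cw bw]] /eqP wz] gw0; exact: zb Pw cw gw0 (bw wz).
have cS w : S w -> {for w, continuous g} by move=> [/rz[_ []]].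
have [[w [Sw gw0]]|none] := pselect (exists w, S w /\ g w = 0); last first.
  right; apply/nbhs_ballP; exists r => //= w zw wz.
  by apply/eqP => gw0; apply: none; exists w; do 2?split => //; exact/eqP.
left; have gS : S `&` [set v | g v = 0] = S.
  apply: (punctured_ball_connected (r := r) (z := z) r0).
  - by exists w.
  - exists [set v | g v = 0]°; first exact: open_interior.
    apply/seteqP; split=> v [Sv gv]; split => //; first exact: near_zero.
    exact: interior_subset gv.
  - exists (~` [set v | g v != 0]°); first exact/open_closedC/open_interior.
    apply/seteqP; split=> v [Sv gv]; split => //.
      by move=> /interior_subset /=; rewrite gv eqxx.
    apply: contrapT => /eqP gv0; apply: gv.
    exact: near_neq0 (cS _ Sv) gv0.
have gS' w' : S w' -> S w' /\ g w' = 0 by rewrite -{1}gS.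
(* Vanishing on the punctured disc passes to its centre by continuity. *)
have gz : g z = 0.
  apply: contrapT => /eqP gz0.
  have : \forall v \near z^', g v != 0.
    by apply: nbhs_dnbhs; apply: near_neq0 gz0; exact: nbhs_singleton cg.
  move=> gz'; have [v [/= gv Sv]] := filter_ex (filterI gz' (dnbhs_ball z r0)).
  by have [_ gv0] := gS' _ Sv; rewrite gv0 eqxx in gv.
apply/nbhs_ballP; exists r => //= v zv.
have [->//|/eqP vz] := eqVneq v z.
by have [] := gS' v (conj zv vz).
Qed.

Definition algebraic_on D g :=
  forall z, D z -> {for z, continuous g} /\ algebraic_near z g.

(** The interior of the zero set is closed in D: at a limit point the dichotomy leaves only
    vanishing nearby. *)
Lemma algebraic_on_identity D g z : open D -> connected D ->
  algebraic_on D g -> D z -> (\forall w \near z, g w = 0) ->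
  forall w, D w -> g w = 0.
Proof.
move=> oD cD ag Dz gz w Dw; pose E := [set v | g v = 0]°.
suff : (D `&` E) w by move=> [_ /interior_subset].
rewrite (cD (D `&` E)) //; first by exists z.
  by exists E => //; exact: open_interior.
exists (closure E); first exact: closed_closure.
apply/seteqP; split=> v [Dv Ev]; split;
  [exact: Dv|exact: subset_closure Ev|exact: Dv|].
have [||//|gv] := @algebraic_dichotomy g v; last 1 first.
- have [u [Eu /= uv]] := Ev _ gv.
  have [<-//|/uv] := eqVneq u v.
  have gu0 : g u = 0 by exact: (@interior_subset _ [set v | g v = 0] u Eu).
  by move=> /negP[]; apply/eqP.
- have := open_nbhs_nbhs (conj oD Dv); apply: filterS => u Du.
  by have [] := ag _ Du.
- by have [] := ag _ Dv.
Qed.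

(** This lets the identity principle act on P(z, g) and carry a relation from one point to all of
    D. *)
Lemma algebraic_on_horner2 D g P : algebraic_on D g ->
  algebraic_on D (fun w => P.[(g w)%:P].[w] : Cx R).
Proof.
move=> ag z Dz; have [cz az] := ag _ Dz; split; first exact: continuous_horner2.
elim/poly_ind: P => [|P c IH].
  have -> : (fun w => (0 : {poly {poly C}}).[(g w)%:P].[w]) =
      polyfun (0 : {poly C}).
    by apply/funext => w; rewrite /polyfun !horner0.
  exact: algebraic_near_polyfun.
have -> : (fun w => (P * 'X + c%:P).[(g w)%:P].[w]) =
    (fun w : Cx R => P.[(g w)%:P].[w]) * g + polyfun c.
  by apply/funext => w; rewrite /polyfun !hornerE.
apply: algebraic_nearD; last exact: algebraic_near_polyfun.
exact: algebraic_nearM.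
Qed.

Lemma finite_roots p : p != 0 -> finite_set [set x | p.[x] = 0].
Proof.
move=> p0; have [rs pE] := closed_field_poly_normal p.
apply: (@sub_finite_set _ _ [set` rs]); last exact: finite_seq.
move=> x /= /rootP; rewrite pE rootZ ?lead_coef_eq0//.
by rewrite root_prod_XsubC.
Qed.

(** With one P valid on D, a zero of g off the roots of b makes g vanish nearby, hence on D;
    otherwise all zeros are among these roots. *)
Lemma algebraic_on_finite D g : open D -> connected D -> algebraic_on D g ->
  (forall z, D z -> g z = 0) \/ finite_set [set z | D z /\ g z = 0].
Proof.
move=> oD cD ag; have [[z0 Dz0]|D0] := pselect (D !=set0); last first.
  by left=> z Dz; case: D0; exists z.
have [_ [P P0 Pz0]] := ag _ Dz0.
have PD := algebraic_on_identity oD cD (algebraic_on_horner2 P ag) Dz0 Pz0.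
have [b b0 zb] := algebraic_zero_near P0.
have [[w [Dw gw bw]]|none] := pselect
  (exists w, [/\ D w, g w = 0 & b.[w] != 0]).
  left; apply: (algebraic_on_identity oD cD ag Dw).
  apply: (zb g w _ _ gw bw); last by have [] := ag _ Dw.
  by apply: filterS (open_nbhs_nbhs (conj oD Dw)); exact: PD.
right; apply: sub_finite_set (finite_roots b0) => w [Dw gw] /=.
by apply: contrapT => /eqP bw; apply: none; exists w.
Qed.

Lemma algebraic_onD D g h : algebraic_on D g -> algebraic_on D h ->
  algebraic_on D (fun z => g z + h z).
Proof.
move=> ag ah z Dz; have [cg ng] := ag _ Dz; have [ch nh] := ah _ Dz.
split; last exact: (algebraic_nearD ng nh).
by move: cg ch; apply: continuousD.
Qed.

Lemma algebraic_onM D g h : algebraic_on D g -> algebraic_on D h ->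
  algebraic_on D (fun z => g z * h z).
Proof.
move=> ag ah z Dz; have [cg ng] := ag _ Dz; have [ch nh] := ah _ Dz.
split; last exact: (algebraic_nearM ng nh).
by move: cg ch; apply: continuousM.
Qed.

Lemma algebraic_on_cst D (c : C) : algebraic_on D (fun=> c).
Proof.
move=> z _; split; first exact: cst_continuous.
have -> : (fun=> c) = polyfun c%:P by apply/funext => w;
  rewrite /polyfun hornerC.
exact: algebraic_near_polyfun.
Qed.

Lemma eq_algebraic_on D g h : open D -> (forall z, D z -> g z = h z) ->
  algebraic_on D g -> algebraic_on D h.
Proof.
move=> oD gh ag z Dz; have [cg [P P0 Pg]] := ag _ Dz.
have nD : \forall w \near z, g w = h w.
  by apply: filterS (open_nbhs_nbhs (conj oD Dz)).
split; last by exists P => //; apply: filterS2 nD Pg => w ->.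
have := cg; rewrite /prop_for /continuous_at (gh _ Dz); apply: cvg_trans.
exact: near_eq_cvg nD.
Qed.

Lemma nash_algebraic_on D g : complex_nash D g -> algebraic_on D g.
Proof.
move=> ng z Dz; have [U [oU Uz UD dg [P P0 Pg]]] := ng _ Dz.
split; first by apply/differentiable_continuous/derivable1_diffP/dg.
by exists P => //; apply: filterS (open_nbhs_nbhs (conj oU Uz)) => w /Pg.
Qed.

End AlgebraicIdentity.

(** * Continuity of the inner product *)

Section CayleyDicksonTopology.
Variables (R : realType) (T : topologicalType).

Lemma continuous_cd_dot k (u v : T -> cd R k) :
  continuous u -> continuous v -> continuous (fun x => cd_dot (u x) (v x) : R).
Proof.
elim: k u v => [|k IH] u v cu cv x /=; first exact: (continuousM (cu x) (cv x)).
apply: (@continuousD _ _ _ (fun x => cd_dot (u x).1 (v x).1 : R^o)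
  (fun x => cd_dot (u x).2 (v x).2 : R^o)).
  by apply: IH => y;
    [apply: (continuous_comp (cu y))|apply: (continuous_comp (cv y))];
    exact: cvg_fst.
by apply: IH => y;
  [apply: (continuous_comp (cu y))|apply: (continuous_comp (cv y))];
  exact: cvg_snd.
Qed.

Lemma continuous_cd_re k (u : T -> cd R k) :
  continuous u -> continuous (fun x => cd_re (u x) : R).
Proof.
move=> cu; have -> : (fun x => cd_re (u x)) =
    (fun x => cd_dot (u x) (cd_one R k)).
  by apply/funext => x; rewrite cd_dotx1.
by apply: continuous_cd_dot => // x; exact: cst_continuous.
Qed.

End CayleyDicksonTopology.

(** * Imaginary units, slices and spheres *)

Section SlicePoints.
Variables (R : realType) (A : alg_name).
Local Notation Re := (@complex.Re R).
Local Notation Im := (@complex.Im R).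
Local Notation alg := (alg R A).
Implicit Types (x y : alg) (z w : Cx R) (I J : alg).

(** Norms in I^2 = -1 give |I|^4 = 1, and positivity selects the root. *)
Lemma imag_unit_dot I : imag_units I -> cd_dot I I = 1.
Proof.
move=> II; have := amul_dot I I; rewrite II -scaleN1r cd_dotZr cd_dotC cd_dotZr.
rewrite cd_dotx1 cd_re1 mulr1 mulrNN mulr1 -expr2 => /esym/eqP.
by rewrite sqrf_eq1 => /orP[/eqP//|/eqP d]; have := cd_dotxx_ge0 I; rewrite d;
  lra.
Qed.

Lemma imag_unit_re I : imag_units I -> cd_re I = 0.
Proof.
move=> II; have := re_sqr I; rewrite II imag_unit_dot//.
have -> : cd_re (- aone R A) = -1.
  by rewrite -scaleN1r -cd_dotx1 cd_dotC cd_dotZr cd_dotx1 cd_re1 mulr1.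
move=> H; apply/eqP; rewrite -sqrf_eq0; apply/eqP; lra.
Qed.

Lemma imag_unitsN I : imag_units I -> imag_units (- I).
Proof.
by rewrite /imag_units /= -(scaleN1r I) /amul cd_mulZl cd_mulZr scalerA mulrNN
  mulr1 scale1r.
Qed.

Lemma dot_slice_pt y z I :
  cd_dot y (slice_pt z I) = Re z * cd_re y + Im z * cd_dot y I.
Proof. by rewrite /slice_pt cd_dotDr !cd_dotZr cd_dotx1. Qed.

Lemma re_slice_pt z I : imag_units I -> cd_re (slice_pt z I) = Re z.
Proof.
move=> hI; rewrite -cd_dotx1 cd_dotC dot_slice_pt cd_re1 cd_dotC cd_dotx1
  imag_unit_re//.
by rewrite mulr0 addr0 mulr1.
Qed.

Lemma dotxx_slice_pt z I : imag_units I ->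
  cd_dot (slice_pt z I) (slice_pt z I) = Re z ^+ 2 + Im z ^+ 2.
Proof.
move=> hI; rewrite dot_slice_pt re_slice_pt// cd_dotC dot_slice_pt.
by rewrite imag_unit_re// imag_unit_dot//; ring.
Qed.

Lemma amul_slice_pt z I x :
  amul (slice_pt z I) x = Re z *: x + Im z *: amul I x.
Proof. by rewrite /amul cd_mulDl !cd_mulZl (cd_mul1 _ _).1. Qed.

(* Real part and squared norm: together they determine the sphere of x. *)
Definition sphere_coord x : Cx R := (cd_re x +i* cd_dot x x)%C.

Lemma sphere_coord_slice_pt z I : imag_units I ->
  sphere_coord (slice_pt z I) = (Re z +i* (Re z ^+ 2 + Im z ^+ 2))%C.
Proof. by move=> hI; rewrite /sphere_coord re_slice_pt// dotxx_slice_pt. Qed.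

Lemma continuous_sphere_coord : continuous sphere_coord.
Proof.
have cid : continuous (fun x : alg => x) by move=> x; exact: cvg_id.
by apply: continuous_complex;
  [exact: continuous_cd_re|exact: continuous_cd_dot].
Qed.

Lemma slice_pt_conj z I : slice_pt (conjc z) (- I) = slice_pt z I.
Proof. by case: z => a b; rewrite /slice_pt /= scalerN scaleNr opprK. Qed.

(** Equal real parts and norms leave Im w = Im z or Im w = - Im z; in the second case the sign moves
    into the unit. *)
Lemma same_sphere z w I J : imag_units I -> imag_units J ->
  sphere_coord (slice_pt z I) = sphere_coord (slice_pt w J) ->
  (w = z \/ w = conjc z) /\
  exists2 K, imag_units K & slice_pt w J = slice_pt z K.
Proof.
move=> hI hJ; rewrite !sphere_coord_slice_pt// => -[zw].
rewrite zw => /addrI/eqP; rewrite eqf_sqr => /orP[]/eqP zw'.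
  have -> : w = z by case: z w zw zw' {I hI J hJ} => ? ? [? ?] /= -> ->.
  by split; [left|exists J].
have -> : w = conjc z by case: z w zw zw' {I hI J hJ} => ? ? [? ?] /= -> ->;
  rewrite opprK.
split; [by right|exists (- J); first exact: imag_unitsN].
by rewrite -slice_pt_conj conjcK.
Qed.

End SlicePoints.

(** * The normal function of a stem-Nash function *)

Section Nash.
Variable R : realType.
Local Notation C := R[i].
Local Notation Re := (@complex.Re R).
Local Notation Im := (@complex.Im R).
Implicit Types (z w : Cx R) (D : set (Cx R)).

(* The complex-bilinear extension <v, F_1> + iota <v, F_2>. *)
Definition pairing k (v : cd R k) (F : Cx R -> cd R k * cd R k) :
  Cx R -> Cx R :=
  fun z => (cd_dot v (F z).1 +i* cd_dot v (F z).2)%C.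

(* The extension <F, F> of the squared norm, that is the stem function of the
   normal function of the slice function induced by F. *)
Definition normal_fun k (F : Cx R -> cd R k * cd R k) : Cx R -> Cx R :=
  fun z => ((cd_dot (F z).1 (F z).1 - cd_dot (F z).2 (F z).2)
            +i* (2 * cd_dot (F z).1 (F z).2))%C.

(** At level 0 the normal function is the square of the pairing with 1; doubling adds the normal
    functions of the two halves. *)
Lemma algebraic_on_normal_fun D k (F : Cx R -> cd R k * cd R k) : open D ->
  (forall v, algebraic_on D (pairing v F)) -> algebraic_on D (normal_fun F).
Proof.
move=> oD; elim: k F => [|k IH] F aF.
  apply: (eq_algebraic_on oD _ (algebraic_onM (aF 1) (aF 1))) => z _.
  by apply/eqP; rewrite eq_complex /=; apply/andP; split; apply/eqP; ring.
pose F1 z := ((F z).1.1, (F z).2.1); pose F2 z := ((F z).1.2, (F z).2.2).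
have a1 : algebraic_on D (normal_fun F1).
  apply: IH => v; apply: (eq_algebraic_on oD _ (aF (v, 0))) => z _.
  by rewrite /pairing /= ![cd_dot 0 _]cd_dotC !cd_dot0r !addr0.
have a2 : algebraic_on D (normal_fun F2).
  apply: IH => v; apply: (eq_algebraic_on oD _ (aF (0, v))) => z _.
  by rewrite /pairing /= ![cd_dot 0 _]cd_dotC !cd_dot0r !add0r.
apply: (eq_algebraic_on oD _ (algebraic_onD a1 a2)) => z _.
by apply/eqP; rewrite eq_complex /=; apply/andP; split; apply/eqP; ring.
Qed.

Lemma algebraic_on_sum D n (G : 'I_n -> Cx R -> Cx R) :
  (forall k, algebraic_on D (G k)) -> algebraic_on D (fun z => \sum_k G k z).
Proof.
move=> aG; elim: n G aG => [|n IH] G aG.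
  have -> : (fun z => \sum_k G k z) = (fun=> 0) by apply/funext => z;
    rewrite big_ord0.
  exact: algebraic_on_cst.
have -> : (fun z => \sum_k G k z) =
    (fun z => G ord0 z + \sum_k G (lift ord0 k) z).
  by apply/funext => z; rewrite big_ord_recl.
by apply: algebraic_onD; [exact: aG|apply: IH].
Qed.

Variable A : alg_name.
Local Notation alg := (alg R A).

(** The pairing is complex-linear in F, hence a combination of the Nash components with the
    constants <v, e_k> and <v, I e_k>. *)
Lemma stem_nash_pairing D (F : Cx R -> algCx R A) (v : alg) : open D ->
  stem_nash D F -> algebraic_on D (pairing v F).
Proof.
move=> oD [I [e [G1 [G2 [hI _ sF aG]]]]].
pose H k z : Cx R := G1 k z * (cd_dot v (e k))%:C%C +
  G2 k z * (cd_dot v (amul I (e k)))%:C%C.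
have aH k : algebraic_on D (H k).
  have [/nash_algebraic_on a1 /nash_algebraic_on a2] := aG k.
  apply: algebraic_onD; apply: algebraic_onM; do ?exact: algebraic_on_cst.
    exact: a1.
  exact: a2.
apply: (eq_algebraic_on oD _ (algebraic_on_sum aH)) => z /sF[F1 F2].
rewrite /pairing F1 F2.
have dot_sum (c : 'I_(alg_u A).+1 -> Cx R) :
    cd_dot v (\sum_k amul (slice_pt (c k) I) (e k)) =
    \sum_k (Re (c k) * cd_dot v (e k) + Im (c k) * cd_dot v (amul I (e k))).
  rewrite (big_morph (cd_dot v) (@cd_dotDr _ _ _) (cd_dot0r _)).
  by apply: eq_bigr => k _; rewrite amul_slice_pt cd_dotDr !cd_dotZr.
rewrite !dot_sum; apply: (big_ind3 (fun (c : C) x y => c = (x +i* y)%C)).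
- by [].
- by move=> _ x y _ x' y' -> ->.
- move=> k _; rewrite /H; case: (G1 k z) (G2 k z) => [a b] [c d].
  by apply/eqP; rewrite eq_complex /=; apply/andP; split; apply/eqP; ring.
Qed.

(** Here F_1 = - I F_2, so |F_1| = |F_2|, and <I F_2, F_2> = Re(I) |F_2|^2 = 0. *)
Lemma normal_fun_zero (F : Cx R -> algCx R A) z I : imag_units I ->
  (F z).1 + amul I (F z).2 = 0 -> normal_fun F z = 0.
Proof.
move=> hI /eqP; rewrite addr_eq0 => /eqP F1.
have dN (x y : alg) : cd_dot (- x) y = - cd_dot x y.
  by rewrite cd_dotC -scaleN1r cd_dotZr mulN1r cd_dotC.
rewrite /normal_fun F1 !dN [cd_dot _ (- _)]cd_dotC dN opprK amul_dot amul_dotr.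
rewrite imag_unit_dot// imag_unit_re// mul1r subrr mul0r oppr0 mulr0.
by [].
Qed.

(** Cancellation comes from |(I - J) x| = |I - J| |x|, with no appeal to associativity. *)
Lemma amul_unit_inj (I J x : alg) : amul I x = amul J x -> x <> 0 -> I = J.
Proof.
move=> IJ x0; apply/eqP; rewrite -subr_eq0; apply/eqP/cd_dotxx_eq0.
have : amul (I - J) x = 0.
  by rewrite /amul cd_mulDl -scaleN1r cd_mulZl scaleN1r; apply/eqP;
    rewrite subr_eq0; apply/eqP.
move/(congr1 (fun y => cd_dot y y)); rewrite amul_dot cd_dot0r => /eqP.
by rewrite mulf_eq0 => /orP[/eqP//|/eqP/cd_dotxx_eq0].
Qed.

End Nash.

(** * Connectedness of D, its real points, and vanishing of the stem function *)

Section Slices.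
Variables (R : realType) (A : alg_name).
Local Notation Re := (@complex.Re R).
Local Notation Im := (@complex.Im R).
Local Notation alg := (alg R A).
Implicit Types (z w : Cx R) (I J : alg) (D : set (Cx R)).
Implicit Types (F : Cx R -> algCx R A).

(** D is the image of the slice under the coordinates [p] of C_I. A point of the slice may come from
    another unit J and some z in D, but its coordinate is then z or its conjugate, again in D. *)
Lemma circularization_connected D I : conj_invariant D -> imag_units I ->
  connected (circularization D `&` slice_plane I) -> connected D.
Proof.
move=> Dc hI cD; pose p x : Cx R := (cd_re x +i* cd_dot I x)%C.
have pE z : p (slice_pt z I) = z.
  rewrite /p re_slice_pt// dot_slice_pt imag_unit_re// imag_unit_dot//.
  by case: z => a b /=; rewrite mulr0 add0r mulr1.
have -> : D = p @` (circularization D `&` slice_plane I).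
  apply/seteqP; split=> [z Dz|_ [x [[z [J [Dz hJ ->]] [w _ wz]] <-]]].
    by exists (slice_pt z I) => //; split; [exists z, I|exists z].
  have [[wE|wE] _] := same_sphere hJ hI (congr1 (@sphere_coord _ _) (esym wz)).
    by rewrite -wz pE wE.
  by rewrite -wz pE wE; exact: Dc.
apply: connected_continuous_connected => //; apply: continuous_subspaceT.
have cid : continuous (fun x : alg => x) by move=> x; exact: cvg_id.
apply: continuous_complex; first exact: continuous_cd_re.
by apply: continuous_cd_dot => // x; exact: cst_continuous.
Qed.

(** The imaginary parts of points of D form an interval symmetric about 0. *)
Lemma conj_connected_real D : conj_invariant D -> connected D -> D !=set0 ->
  exists2 z, D z & Im z = 0.
Proof.
move=> Dc cD [z Dz].
have /connected_intervalP iD : connected (Im @` D).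
  by apply: connected_continuous_connected => //; apply: continuous_subspaceT;
    exact: continuous_Im.
have D1 : (Im @` D) (Im z) by exists z.
have D2 : (Im @` D) (- Im z) by exists (conjc z); [exact: Dc|case: (z)].
suff [w Dw <-] : (Im @` D) 0 by exists w.
have [z0|z0] := leP 0 (Im z).
  by apply: (iD _ _ D2 D1); rewrite oppr_le0 z0.
by apply: (iD _ _ D1 D2); rewrite oppr_ge0 ltW.
Qed.

(** A real point z of D is a limit of other real points of D, which excludes that g has no zeros
    nearby off z. *)
Lemma algebraic_on_real_zero D (g : Cx R -> Cx R) z : open D -> connected D ->
  algebraic_on D g -> D z -> Im z = 0 ->
  (forall w, D w -> Im w = 0 -> g w = 0) -> forall w, D w -> g w = 0.
Proof.
move=> oD cD ag Dz z0 gr.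
have nD : \forall w \near z, D w by exact: (open_nbhs_nbhs (conj oD Dz)).
have cg : \forall w \near z, {for w, continuous g}.
  by apply: filterS nD => w /ag[].
have [gz|gz] := algebraic_dichotomy cg (ag _ Dz).2.
  exact: (algebraic_on_identity oD cD ag Dz gz).
exfalso.
have zE : z = (Re z)%:C%C by case: z z0 {Dz nD cg gz} => a b /= ->.
have cz : (t%:C%C : Cx R) @[t --> Re z] --> z.
  by rewrite [X in _ --> X]zE; exact: continuous_real_complex.
have H : \forall t \near (Re z)^',
    [/\ t != Re z, D t%:C%C & t%:C%C != z -> g t%:C%C != 0].
  near=> t; split.
  - by near: t; exact: nbhs_dnbhs_neq.
  - by near: t; apply: nbhs_dnbhs; exact: (cz _ nD).
  - by near: t; apply: nbhs_dnbhs; exact: (cz _ gz).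
have [t [tz Dt]] := filter_ex H.
rewrite gr// eqxx => /(_ _)/notF; apply.
by apply: contra tz => /eqP/(congr1 Re) /= ->.
Unshelve. all: by end_near. Qed.

(** At a real point the stem condition gives F_2 = 0, so N = |F_1|^2 and F = 0 there; the pairings
    of F then vanish on all of D. *)
Lemma normal_fun_zero_stem D F z : stem_function D F -> connected D ->
  (forall v, algebraic_on D (pairing v F)) -> D z -> Im z = 0 ->
  (forall w, D w -> normal_fun F w = 0) -> forall w, D w -> F w = 0.
Proof.
move=> [oD Dc Fc] cD aF Dz z0 N0 w Dw.
have real0 u : D u -> Im u = 0 -> F u = 0.
  move=> Du u0; have uc : conjc u = u by case: u u0 {Du} => a b /= ->;
    rewrite oppr0.
  have := Fc _ Du; rewrite uc.
  have := N0 _ Du; rewrite /normal_fun; case: (F u) => x y /= => -[+ _] [/eqP].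
  rewrite -subr_eq0 opprK -mulr2n -scaler_nat scaler_eq0 pnatr_eq0 /= =>
    + /eqP y0.
  by rewrite y0 cd_dot0r subr0 => /cd_dotxx_eq0 ->.
have pair0 v : pairing v F w = 0.
  apply: (algebraic_on_real_zero oD cD (aF v) Dz z0) => // u Du u0.
  by rewrite /pairing real0//= cd_dot0r.
(* Pairing F(w) with its own components gives |F_1|^2 = |F_2|^2 = 0. *)
have [x0 _] := pair0 (F w).1; have [_ y0] := pair0 (F w).2.
by rewrite [F w]surjective_pairing (cd_dotxx_eq0 x0) (cd_dotxx_eq0 y0).
Qed.

End Slices.

(** * The zero set and its fibres over the spheres *)

Lemma finite_fibers (T U : topologicalType) (q : T -> U) (V : set T) :
  accessible_space U -> continuous q -> finite_set (q @` V) ->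
  forall x, V x -> exists2 O, open O & O x /\ O `&` V = V `&` q @^-1` [set q x].
Proof.
(* The other values of [q] on V form a finite, hence closed, set; the preimage of its complement is
   the neighbourhood. *)
move=> aU cq fV x Vx; exists (q @^-1` ~` ((q @` V) `\ q x)).
  apply: open_comp => //; apply: closed_openC.
  apply: (proj1 accessible_finite_set_closed aU); exact: finite_setD.
split; first by move=> [_ /=]; exact.
apply/seteqP; split=> y.
  by move=> [/= qy Vy]; split => //=; apply: contrapT => qyx; apply: qy;
    split => //; exists y.
by move=> [Vy /= qy]; split; [move=> [_ /=]; exact|].
Qed.

(** On the sphere over z, the value F_1 + J F_2 is constant in the unit J if F_2(z) = 0 and
    injective in J otherwise. Over a real z the sphere is a point. *)
Lemma zero_fiber (R : realType) (A : alg_name) (D : set (Cx R))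
    (F : Cx R -> algCx R A) (f : alg R A -> alg R A) (x : alg R A) :
  let V := zero_set (circularization D) f in
  let S := V `&` (@sphere_coord R A) @^-1` [set sphere_coord x] in
  conj_invariant D -> induces D F f -> V x ->
  S = [set x] \/ [/\ ~ real_axis x, S = sphere_of x & sphere_of x `<=` V].
Proof.
move=> V S Dc Ff Vx; have [[z [I [Dz hI xE]]] fx0] := Vx.
have SE y : S y -> exists2 J, imag_units J & y = slice_pt z J.
  move=> [[[w [J [Dw hJ ->]]] _] /= qy].
  by have [_] := same_sphere hI hJ (etrans (congr1 (@sphere_coord _ _)
    (esym xE)) (esym qy)).
have Sx : S x by [].
have one y : (S y -> y = x) -> S y -> [set x] y by move=> yx /yx ->.
have f0 J : imag_units J -> f (slice_pt z J) = (F z).1 + amul J (F z).2 by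
  exact: Ff.
have [z0|/eqP z0] := eqVneq (complex.Im z) 0.
  left; apply/seteqP; split=> [y|_ -> //]; apply: one => /SE[J hJ ->].
  by rewrite xE /slice_pt z0 !scale0r.
have [F2|/eqP F2] := eqVneq (F z).2 0; last first.
  left; apply/seteqP; split=> [y|_ -> //]; apply: one => Sy.
  have [J hJ yE] := SE _ Sy; rewrite yE xE; congr slice_pt.
  apply: amul_unit_inj F2; apply: (@addrI _ (F z).1).
  by rewrite -!f0// -yE -xE fx0; case: Sy => -[].
have fz J : imag_units J -> f (slice_pt z J) = 0.
  move=> hJ; rewrite f0// F2 /amul cd_mul0r addr0.
  by have := fx0; rewrite xE f0// F2 /amul cd_mul0r addr0.
have VJ J : imag_units J -> V (slice_pt z J).
  by move=> hJ; split; [exists z, J|exact: fz].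
right; have sV : sphere_of x `<=` S.
  move=> y [w [J [K [hJ hK xw ->]]]].
  have q : sphere_coord (slice_pt z I) = sphere_coord (slice_pt w K).
    by rewrite -xE xw !sphere_coord_slice_pt.
  have [_ [L hL ->]] := same_sphere hI hK q.
  by split; [exact: VJ|rewrite /= xE !sphere_coord_slice_pt].
split; last by move=> y /sV[].
  (* For real x, comparing norms gives r^2 = r^2 + (Im z)^2, against Im z <> 0. *)
  move=> [r _ rx]; have := congr1 (@sphere_coord _ _) rx.
  rewrite xE sphere_coord_slice_pt// /sphere_coord.
  rewrite cd_dotZr cd_dotx1 -[cd_re _]cd_dotx1 cd_dotC cd_dotZr cd_dotx1 cd_re1
    mulr1.
  by move=> -[<-]; rewrite -expr2 -{1}[_ ^+ 2]addr0 => /addrI/esym/eqP;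
    rewrite sqrf_eq0 => /eqP.
apply/seteqP; split=> // y /SE[J hJ ->]; exists z, I, J; by [].
Qed.

Unset Implicit Arguments.

Theorem corollary6p4 (R : realType) (A : alg_name) (Omega : set (alg R A))
    (f : alg R A -> alg R A)
    (hOmega : symmetric_slice_domain Omega)
    (hf : slice_nash Omega f)
    (hf0 : exists2 x, Omega x & f x <> 0) :
  exists (Z : set (alg R A)) (Sph : set (set (alg R A))),
    [/\ finite_set Z, finite_set Sph,
        Z `<=` isolated (zero_set Omega f),
        forall S, Sph S -> isolated_spherical_zero Omega f S
      & zero_set Omega f = Z `|` \bigcup_(S in Sph) S].
Proof.
have [[Ocirc _ _] cI] := hOmega.
have [D [F [OD stemF Ff _ nF]]] := hf.
have [oD Dc _] := stemF.
have [I [_ [_ [_ [hI _ _ _]]]]] := nF.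
have cD : connected D.
  by apply: (circularization_connected Dc hI); rewrite -OD; exact: cI.
have [x0 Ox0 fx0] := hf0.
have [z0 [I0 [Dz0 hI0 x0E]]] : circularization D x0 by rewrite -OD.
have [r Dr r0] := conj_connected_real Dc cD (ex_intro _ _ Dz0).
have aF v : algebraic_on D (pairing v F) by exact: stem_nash_pairing.
set V := zero_set Omega f.
pose q := @sphere_coord R A.
have fqV : finite_set (q @` V).
  (* A vanishing normal function would give F = 0 at [z0], against f(x0) <> 0. *)
  have [N0|] := algebraic_on_finite oD cD (algebraic_on_normal_fun oD aF).
    have := normal_fun_zero_stem stemF cD aF Dr r0 N0 Dz0.
    move=> Fz0; exfalso; apply: fx0.
    by rewrite x0E Ff// Fz0 /amul cd_mul0r addr0.
  (* The common value of [q] on the sphere over z. *)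
  pose p (z : Cx R) : Cx R :=
    (complex.Re z +i* (complex.Re z ^+ 2 + complex.Im z ^+ 2))%C.
  move=> /(finite_image p); apply: sub_finite_set => _ [x [+ fx] <-].
  rewrite OD => -[z [J [Dz hJ xE]]]; exists z;
    last by rewrite xE /q sphere_coord_slice_pt.
  split; first exact: Dz.
  by apply: (normal_fun_zero hJ); rewrite -Ff// -xE.
have accC : accessible_space (Cx R).
  by apply: hausdorff_accessible; exact: norm_hausdorff.
(* Every fibre of [q] in V is open in V, which isolates both kinds of zeros. *)
have iso := finite_fibers accC (@continuous_sphere_coord R A) fqV.
pose fib t := V `&` q @^-1` [set t].
(* Singleton fibres supply the isolated zeros, the other fibres whole spheres. *)
exists [set x | V x /\ fib (q x) = [set x]].
exists [set S | isolated_spherical_zero Omega f S /\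
                exists2 x, V x & S = fib (q x)].
split.
(* A point alone in its fibre is recovered by [xget] from its value under [q]; [x0] is only the
   default. *)
- have := finite_image (fun t => xget x0 (fib t)) fqV.
  apply: sub_finite_set => x [Vx fx]; exists (q x); first by exists x.
  by rewrite fx; apply: xget_subset1 => // u v -> ->.
- apply: sub_finite_set (finite_image fib fqV) => S [_ [x Vx ->]].
  by exists (q x) => //; exists x.
- move=> x [Vx fx]; split; first exact/mem_set.
  have [W oW [Wx WV]] := iso x Vx; exists W; first exact: open_nbhs_nbhs.
  by rewrite WV -fx.
- by move=> S [].
- apply/seteqP; split=> x; last first.
    by case=> [[]//|[S [_ [y Vy ->]] []]].
  move=> Vx; have := @zero_fiber R A D F f x;
    rewrite -OD => /(_ Dc Ff Vx)[fx|[xr fx sV]].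
    by left.
  right; exists (fib (q x)) => //; split; last by exists x.
  have fx' : fib (q x) = sphere_of x by exact: fx.
  exists x; rewrite fx'; split=> //.
  by have [W oW [_ WV]] := iso x Vx; exists W => //; rewrite WV; exact: fx.
Qed.
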